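(* Let $K_n=(V,E)$ be the complete graph on $n\ge 2$ nodes and let $P_{\mathrm{match}}(n)=\operatorname{conv}\{\chi(M): M \text{ a matching in } K_n\}\subseteq\mathbb{R}^E$ be the Matching polytope, whose circuits are taken with respect to the linear description $$\bm{x}(E[S])\le (|S|-1)/2 \ \ \text{for all } S\subseteq V,\ |S| \text{ odd},\ |S|\ge 3;\qquad \bm{x}(\delta(v))\le 1\ \ \text{for all } v\in V;\qquad \bm{x}\ge \bm{0}.$$ Then the circuit diameter of $P_{\mathrm{match}}(n)$ is $$\mathcal{CD}(P_{\mathrm{match}}(n))=\begin{cases}1 & n=2,3,\\ 2 & n=4,5,\\ 3 & n=6,\\ 2 & n\ge 7.\end{cases}$$
   Context: For a matching (edge set) $M$, $\chi(M)\in\{0,1\}^E$ is its characteristic vector. $E[S]$ is the set of edges with both endpoints in $S$, $\delta(v)$ the set of edges incident to $v$, and $\bm{x}(F)=\sum_{e\in F}x_e$. Circuits: for a polytope $P=\{\bm{x}: A\bm{x}=\bm{b},\ B\bm{x}\le \bm{d}\}$ given by a fixed linear system, a nonzero vector $\bm{g}$ is a circuit of $P$ if $A\bm{g}=\bm{0}$ and $\operatorname{supp}(B\bm{g})$ is inclusion-minimal among the sets $\operatorname{supp}(B\bm{y})$ with $A\bm{y}=\bm{0}$, $\bm{y}\neq\bm{0}$. A point $\bm{x}''\in P$ is one circuit step from $\bm{x}'\in P$ if $\bm{x}''=\bm{x}'+\alpha\bm{c}$ for a circuit $\bm{c}$ and $\alpha>0$ maximal such that $\bm{x}'+\alpha\bm{c}\in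 P$. A circuit walk from $\bm{x}'$ to $\bm{x}''$ of length $l$ is a sequence $\bm{x}'=\bm{z}^0,\dots,\bm{z}^l=\bm{x}''$ of points of $P$ with each $\bm{z}^i$ one circuit step from $\bm{z}^{i-1}$. The circuit distance $\mathrm{cdist}(\bm{x}',\bm{x}'')$ is the length of a shortest circuit walk from $\bm{x}'$ to $\bm{x}''$ (not necessarily symmetric), and the circuit diameter $\mathcal{CD}(P)$ is the maximum circuit distance over all ordered pairs of vertices of $P$. *)

(* Defs.v *)
From HB Require Import structures.
From mathcomp Require Import all_boot all_order all_algebra.
From mathcomp Require Import reals.
Set Implicit Arguments. Unset Strict Implicit. Unset Printing Implicit Defensive.
Import Order.TTheory GRing.Theory Num.Theory.
Local Open Scope ring_scope.

Definition edge (n : nat) := {e : {set 'I_n} | #|e| == 2%N}.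

Definition vec (R : realType) (n : nat) := edge n -> R.

Definition is_matching (n : nat) (M : {set edge n}) : bool :=
  [forall e in M, forall f in M, (e != f) ==> [disjoint val e & val f]].

Definition chi (R : realType) (n : nat) (M : {set edge n}) : vec R n :=
  fun e => if e \in M then 1 else 0.

Definition xsum (R : realType) (n : nat) (x : vec R n) (F : pred (edge n)) : R :=
  \sum_(e | F e) x e.

Definition inside (n : nat) (S : {set 'I_n}) : pred (edge n) :=
  fun e => val e \subset S.
Definition delta (n : nat) (v : 'I_n) : pred (edge n) :=
  fun e => v \in val e.

Definition in_Pmatch (R : realType) (n : nat) (x : vec R n) : Prop :=
  exists lam : {set edge n} -> R,
    (forall M, 0 <= lam M) /\
    (forall M, ~~ is_matching M -> lam M = 0) /\
    \sum_(M : {set edge n}) lam M = 1 /\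
    (forall e, x e = \sum_(M : {set edge n}) lam M * chi R M e).

Definition is_vertex (R : realType) (n : nat) (x : vec R n) : Prop :=
  in_Pmatch x /\
  forall (y z : vec R n) (t : R), in_Pmatch y -> in_Pmatch z -> 0 < t -> t < 1 ->
    (forall e, x e = t * y e + (1 - t) * z e) -> forall e, y e = z e.

(* The rows of the linear description B x <= d (there are no equalities):
   x(E[S]) <= (|S|-1)/2 for S odd, |S| >= 3;  x(delta v) <= 1;  -x_e <= 0. *)
Inductive constr (n : nat) :=
  | OddSet of {set 'I_n}
  | Deg of 'I_n
  | NonNeg of edge n.

Definition is_row (n : nat) (c : constr n) : bool :=
  match c with
  | OddSet T => odd #|T| && (3 <= #|T|)%N
  | _ => true
  end.

Definition Brow (R : realType) (n : nat) (c : constr n) (g : vec R n) : R :=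
  match c with
  | OddSet T => xsum g (inside T)
  | Deg v => xsum g (delta v)
  | NonNeg e => - g e
  end.

(* right-hand sides d (not needed for circuits, recorded for completeness) *)
Definition rhs (R : realType) (n : nat) (c : constr n) : R :=
  match c with
  | OddSet T => (#|T|%:R - 1) / 2
  | Deg _ => 1
  | NonNeg _ => 0
  end.

Definition Bsupp (R : realType) (n : nat) (g : vec R n) (c : constr n) : bool :=
  is_row c && (Brow c g != 0).

Definition nonzero (R : realType) (n : nat) (g : vec R n) : Prop :=
  exists e, g e != 0.

(* circuits: nonzero g (A g = 0 is vacuous) with supp(B g) inclusion-minimal *)
Definition is_circuit (R : realType) (n : nat) (g : vec R n) : Prop :=
  nonzero g /\
  forall y : vec R n, nonzero y ->
    (forall c, Bsupp y c -> Bsupp g c) -> (forall c, Bsupp g c -> Bsupp y c).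

Definition circuit_step (R : realType) (n : nat) (x x'' : vec R n) : Prop :=
  exists (g : vec R n) (alpha : R),
    is_circuit g /\ 0 < alpha /\
    in_Pmatch (fun e => x e + alpha * g e) /\
    (forall beta, alpha < beta -> ~ in_Pmatch (fun e => x e + beta * g e)) /\
    (forall e, x'' e = x e + alpha * g e).

(* circuit walk of length l from x to y (x is assumed in P) *)
Fixpoint circuit_walk (R : realType) (n : nat) (l : nat) (x y : vec R n) : Prop :=
  match l with
  | 0%N => forall e, x e = y e
  | l'.+1 => exists z : vec R n, circuit_walk l' x z /\ circuit_step z y
  end.

Definition circuit_diameter_is (R : realType) (n : nat) (k : nat) : Prop :=
  (forall u v : vec R n, is_vertex u -> is_vertex v ->
     exists l, (l <= k)%N /\ circuit_walk l u v) /\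
  (exists u v : vec R n, is_vertex u /\ is_vertex v /\
     forall l, (l < k)%N -> ~ circuit_walk l u v).

(* Main.v *)
(** The vertices are the characteristic vectors of matchings, and the step from [chi M]
    to [chi N] is a circuit step exactly when [chi_diff M N = chi N - chi M] is a circuit.
    Degree rows force a vector with smaller row support to be a multiple of
    [chi_diff M N] on each component of the symmetric difference of [M] and [N]. Hence
    switching one component is a circuit step, and the distance is at most the number of
    components, which is at most n / 2. If [e] is in [M] only, [f] is in [N] only and the
    vertex [w] lies in a third component, the row of the odd set [e + f + w] ties [e] to
    [f]; so with at least three components [chi_diff M N] is itself a circuit, unless one
    matching contains the other. If [M] is a subset of [N] and n >= 7, one detours through
    [M] plus an edge joining two edges of [N] outside [M].

    Conversely, a circuit step from the empty matching ends at a single edge, so a second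
    step is needed to reach a matching with two edges. If n = 6, no single edge is one
    circuit step away from a perfect matching, so that a third step is needed. *)
Require Import Defs.
From mathcomp Require Import all_boot all_order all_algebra.
From mathcomp Require Import boolp reals lra zify.

Set Implicit Arguments.
Unset Strict Implicit.
Unset Printing Implicit Defensive.
Import Order.TTheory GRing.Theory Num.Theory.
Local Open Scope ring_scope.

Section SymmetricDifference.
Variable T : finType.
Implicit Types (A B C : {set T}) (x : T).

Definition symdiff A B := (A :\: B) :|: (B :\: A).

Lemma in_symdiff A B x : (x \in symdiff A B) = (x \in A) (+) (x \in B).
Proof. by rewrite !inE; do 2 case: (x \in _). Qed.

Lemma symdiffC A B : symdiff A B = symdiff B A.
Proof. exact: setUC. Qed.

Lemma symdiffKr A C : symdiff (symdiff A C) A = C.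
Proof. by apply/setP => x; rewrite !in_symdiff addbC addKb. Qed.

Lemma symdiff_symdiff_sub A B C : C \subset symdiff A B ->
  symdiff A (symdiff B C) = symdiff A B :\: C.
Proof.
move=> /subsetP CD; apply/setP => x; rewrite in_setD !in_symdiff addbA -in_symdiff.
by case: (boolP (x \in C)) => [/CD->|_]; rewrite ?addbF.
Qed.

Lemma symdiff_eq0 A B : (symdiff A B == set0) = (A == B).
Proof. by rewrite setU_eq0 !setD_eq0 eqEsubset. Qed.

Lemma symdiff_subset A B : A \subset B -> symdiff A B = B :\: A.
Proof. by rewrite -setD_eq0 /symdiff => /eqP->; rewrite set0U. Qed.

End SymmetricDifference.

Section Matchings.
Variable n : nat.
Implicit Types (u v w : 'I_n) (S : {set 'I_n}).
Implicit Types (a b e f k : edge n) (M N C D : {set edge n}).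
Local Open Scope nat_scope.

(** * Edges and matchings *)

Lemma card_edge e : #|val e| = 2.
Proof. exact: (eqP (valP e)). Qed.

Lemma edge_nonempty e : exists v, v \in val e.
Proof. by apply/card_gt0P; rewrite card_edge. Qed.

Lemma edge_subset_eq e f : val e \subset val f -> e = f.
Proof. by move=> ef; apply/val_inj/eqP; rewrite eqEcard ef !card_edge. Qed.

Lemma edge_other_vertex e w : exists2 v, v \in val e & v != w.
Proof.
have /subsetPn[v ve] : ~~ (val e \subset [set w]).
  by apply/negP => /subset_leq_card; rewrite card_edge cards1.
by rewrite inE; exists v.
Qed.

Lemma exists_edge u v : u != v -> exists e : edge n, val e = [set u; v].
Proof.
move=> uv; have uv2 : #|[set u; v]| == 2 by rewrite cards2 uv.
by exists (Sub [set u; v] uv2).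
Qed.

Lemma edge_meets_self e : [disjoint val e & val e] = false.
Proof. by rewrite -setI_eq0 setIid -cards_eq0 card_edge. Qed.

Lemma edge_disjoint_neq e f : [disjoint val e & val f] -> e != f.
Proof. by apply: contraTneq => ->; rewrite edge_meets_self. Qed.

Lemma disjoint_edgePn e S :
  reflect (exists2 v, v \in val e & v \in S) (~~ [disjoint val e & S]).
Proof.
rewrite -setI_eq0; apply: (iffP (set0Pn _)) => [[v]|[v ve vS]].
  by rewrite inE => /andP[]; exists v.
by exists v; rewrite inE ve.
Qed.

Lemma matching_disjoint M e f :
  is_matching M -> e \in M -> f \in M -> e != f -> [disjoint val e & val f].
Proof. by move=> /forall_inP mM /mM/forall_inP eM /eM/implyP. Qed.

Lemma matching_eq M e f v :
  is_matching M -> e \in M -> f \in M -> v \in val e -> v \in val f -> e = f.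
Proof.
move=> mM eM fM ve vf; apply/eqP; apply: contraTT vf => ef.
by rewrite (disjointFr (matching_disjoint mM eM fM ef) ve).
Qed.

Lemma matchingP M :
  reflect (forall e f v, e \in M -> f \in M -> v \in val e -> v \in val f -> e = f)
          (is_matching M).
Proof.
apply: (iffP idP) => [mM e f v|mM]; first exact: matching_eq.
apply/forall_inP => e eM; apply/forall_inP => f fM; apply/implyP.
by apply: contraNT => /disjoint_edgePn[v ve vf]; apply/eqP/(mM e f v).
Qed.

Lemma matchingS M N : M \subset N -> is_matching N -> is_matching M.
Proof.
move=> /subsetP MN mN; apply/matchingP => e f v /MN eN /MN fN.
exact: (matching_eq mN).
Qed.

Lemma matchingU1 M e : is_matching M ->
  {in M, forall f, [disjoint val e & val f]} -> is_matching (e |: M).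
Proof.
move=> mM eM; apply/matchingP => f k v.
move=> /setU1P[->|fM] /setU1P[->|kM] vf vk //.
- by rewrite (disjointFr (eM k kM) vf) in vk.
- by rewrite (disjointFl (eM f fM) vf) in vk.
- exact: (matching_eq mM) vf vk.
Qed.

Lemma matching0 : is_matching (set0 : {set edge n}).
Proof. by apply/matchingP => e f v; rewrite inE. Qed.

Lemma matching1 e : is_matching [set e].
Proof. by apply/matchingP => f k v /set1P-> /set1P->. Qed.

Definition covered M : {set 'I_n} := \bigcup_(e in M) val e.

Lemma leq_card_covered M : #|covered M| <= #|M|.*2 ?= iff trivIset (val @: M).
Proof.
have -> : #|M|.*2 = \sum_(A in val @: M) #|A|.
  rewrite big_imset /=; last by move=> e f _ _; apply: val_inj.
  by rewrite (eq_bigr (fun=> 2)) => [|e _]; rewrite ?sum_nat_const ?muln2 ?card_edge.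
by rewrite /covered -cover_imset; apply: leq_card_cover.
Qed.

Lemma card_matching M : is_matching M -> #|M|.*2 <= n.
Proof.
move=> mM; have /eqP <- : #|covered M| == #|M|.*2.
  rewrite (leq_card_covered M).
  apply/trivIsetP => _ _ /imsetP[e eM ->] /imsetP[f fM ->].
  by rewrite val_eqE; apply: (matching_disjoint mM).
by rewrite -[leqRHS]card_ord max_card.
Qed.

Lemma leq_card_uncovered M : n - #|M|.*2 <= #|~: covered M|.
Proof.
by have := cardsC (covered M); have [+ _] := leq_card_covered M; rewrite card_ord; lia.
Qed.

Lemma exists_vertex_off_edges (s : seq (edge n)) : (size s).*2 < n ->
  exists v, {in s, forall e, v \notin val e}.
Proof.
move=> sn; pose M := [set e in s].
have /card_gt0P[v vM] : 0 < #|~: covered M|.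
  apply: leq_trans (leq_card_uncovered M); rewrite subn_gt0.
  by apply: leq_ltn_trans sn; rewrite leq_double cardsE card_size.
exists v => e es; apply: contraTN vM => ve; rewrite in_setC negbK.
by apply/bigcupP; exists e; rewrite ?inE.
Qed.

Lemma exists_matching m : m.*2 <= n ->
  exists2 M : {set edge n}, is_matching M & #|M| = m.
Proof.
elim: m => [|m IH] mn; first by exists set0; rewrite ?matching0 ?cards0.
have [M mM Mm] : exists2 M : {set edge n}, is_matching M & #|M| = m by apply: IH; lia.
have /card_gt1P[u [v [uM vM uv]]] : 1 < #|~: covered M|.
  by apply: leq_trans (leq_card_uncovered M); lia.
have [e eE] := exists_edge uv; rewrite !in_setC in uM vM.
have eM : {in M, forall f, [disjoint val e & val f]}.
  move=> f fM; rewrite eE disjoints_subset subUset !sub1set !in_setC.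
  apply/andP; split; [apply: contraNN uM|apply: contraNN vM] => ?;
  by apply/bigcupP; exists f.
exists (e |: M); first exact: matchingU1.
rewrite cardsU1 Mm; case: (boolP (e \in M)) => // /eM/edge_disjoint_neq.
by rewrite eqxx.
Qed.

Lemma matching_disjoint_from M S : is_matching M -> #|S| < #|M| ->
  exists2 e, e \in M & [disjoint val e & S].
Proof.
move=> mM; rewrite ltnNge => SM; apply/exists_inP; apply: contraNT SM.
rewrite negb_exists_in => /forall_inP meets.
pose endpoint e := [pick v in val e :&: S].
have endpointP e : e \in M -> exists2 v, endpoint e = Some v & v \in val e :&: S.
  move=> /meets/disjoint_edgePn[w we wS]; rewrite /endpoint.
  by case: pickP => [v vP|/(_ w)]; [exists v|rewrite inE we wS].
have endpoint_inj : {in M &, injective endpoint}.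
  move=> e f eM fM; have [v -> /setIP[ve _]] := endpointP e eM.
  have [w -> /setIP[wf _] [vw]] := endpointP f fM.
  by apply: (matching_eq mM) ve _; rewrite ?vw.
rewrite -(card_in_imset endpoint_inj) -(card_imset (mem S) (@Some_inj _)).
apply: subset_leq_card.
by apply/subsetP => _ /imsetP[e /endpointP[v -> /setIP[_ vS]] ->]; apply: imset_f.
Qed.

(** * Components of a symmetric difference *)

Definition adjacent D : rel (edge n) :=
  fun e f => [&& e \in D, f \in D & ~~ [disjoint val e & val f]].

Lemma adjacent_common_vertex D e f v :
  e \in D -> f \in D -> v \in val e -> v \in val f -> adjacent D e f.
Proof.
by move=> eD fD ve vf; rewrite /adjacent eD fD; apply/disjoint_edgePn; exists v.
Qed.

Lemma adjacent_connect_sym D : connect_sym (adjacent D).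
Proof.
by apply: sym_connect_sym => e f; rewrite /adjacent disjoint_sym andbCA.
Qed.

Lemma connect_adjacent_closed D C e f :
  C \subset D -> closed (adjacent D) (mem C) -> e \in C ->
  connect (adjacent C) e f = connect (adjacent D) e f.
Proof.
move=> /subsetP CD clC eC; apply/idP/idP.
  apply: connect_sub => a b /and3P[/CD aD /CD bD ab].
  by apply: connect1; rewrite /adjacent aD bD.
move=> /connectP[p + ->]; elim: p e eC => [|k p IH] e eC //= /andP[ek kp].
have kC : k \in C by rewrite -(clC e k ek).
apply: connect_trans (IH k kC kp); apply: connect1.
by case/and3P: ek => _ _ ek; rewrite /adjacent eC kC.
Qed.

Definition component D e := [set f in D | connect (adjacent D) e f].

Definition components D := [set component D e | e in D].

Lemma in_component D e f :
  (f \in component D e) = (f \in D) && connect (adjacent D) e f.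
Proof. exact: in_set. Qed.

Lemma mem_component D e : e \in D -> e \in component D e.
Proof. by rewrite in_component connect0 andbT. Qed.

Lemma eq_component D e f : f \in component D e -> component D f = component D e.
Proof.
rewrite in_component => /andP[_ ef]; apply/setP => k; rewrite !in_component.
by rewrite (same_connect (adjacent_connect_sym D) ef).
Qed.

Lemma component_subset D e : component D e \subset D.
Proof. by apply/subsetP => f; rewrite in_component => /andP[]. Qed.

Lemma component_closed D e : closed (adjacent D) (mem (component D e)).
Proof.
apply: intro_closed => [|f k fk]; first exact: adjacent_connect_sym.
rewrite /= !in_component => /andP[_ ef]; case/and3P: (fk) => _ -> _ /=.
exact: connect_trans ef (connect1 fk).
Qed.

Lemma component_connected D e :
  {in component D e &, forall f k, connect (adjacent (component D e)) f k}.
Proof.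
move=> f k fC; rewrite -(eq_component fC) in_component => /andP[_ fk].
rewrite (connect_adjacent_closed k (component_subset D f) (component_closed f)) //.
by rewrite (eq_component fC).
Qed.

Lemma component_setD D e f : f \in D :\: component D e ->
  component (D :\: component D e) f = component D f.
Proof.
set C := component D e => fDC.
have clDC : closed (adjacent D) (mem (D :\: C)).
  move=> k h kh; case/and3P: (kh) => kD hD _.
  by have /= := component_closed e kh; rewrite !in_setD kD hD => ->.
apply/setP => k; rewrite !in_component.
rewrite (connect_adjacent_closed k (subsetDl D C) clDC fDC).
have [fk|] := boolP (connect (adjacent D) f k); last by rewrite !andbF.
have := closed_connect clDC fk; rewrite fDC => kDC; rewrite -kDC.
by have /esym/setDP[-> _] := kDC.
Qed.

Lemma components_setD D e :
  components (D :\: component D e) = components D :\ component D e.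
Proof.
apply/setP => C; apply/imsetP/setD1P => [[f fDe ->]|[Ce /imsetP[f fD CE]]].
  have /setDP[fD fe] := fDe; rewrite component_setD //; split; last exact: imset_f.
  by apply: contraNneq fe => <-; apply: mem_component.
have fDe : f \in D :\: component D e.
  by rewrite in_setD fD andbT; apply: contraNN Ce; rewrite CE => /eq_component->.
by exists f; rewrite ?component_setD.
Qed.

Lemma components_partition D : partition (components D) D.
Proof.
apply: equivalence_partitionP => e f k _ _ _; split; first exact: connect0.
by move=> ef; apply: (same_connect (adjacent_connect_sym D) ef).
Qed.

Lemma pblock_components D e : e \in D -> pblock (components D) e = component D e.
Proof.
move=> eD; have /and3P[_ trivD _] := components_partition D.
by apply: (def_pblock trivD); [apply: imset_f|apply: mem_component].
Qed.

Lemma components_eq0 D : (components D == set0) = (D == set0).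
Proof. by rewrite imset_eq0. Qed.

Lemma card_components_le D : #|components D| <= #|D|.
Proof. exact: leq_imset_card. Qed.

(* Edges chosen in distinct components form a matching. *)
Lemma card_components D : #|components D|.*2 <= n.
Proof.
have tr := transversalP (components_partition D).
rewrite -(card_transversal tr); apply/card_matching/matchingP => e f v eX fX ve vf.
have subD := subsetP (transversal_sub tr).
have [eD fD] := (subD e eX, subD f fX).
apply: (pblock_inj tr) eX fX _; rewrite !pblock_components //.
apply/esym/eq_component; rewrite in_component fD.
exact/connect1/(adjacent_common_vertex eD fD ve vf).
Qed.

Lemma exists_off_two_components D e f : 2 < #|components D| ->
  exists2 k, k \in D & k \notin component D e :|: component D f.
Proof.
move=> many.
have /subsetPn[_ /imsetP[k kD ->]] :
    ~~ (components D \subset [set component D e; component D f]).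
  apply: contraL many => /subset_leq_card; rewrite -leqNgt => /leq_trans; apply.
  by rewrite cards2; case: (_ != _).
move=> kef; exists k => //; apply: contraNN kef.
by move=> /setUP[] /eq_component->; rewrite ?set21 ?set22.
Qed.

Lemma matching_symdiff M N C : is_matching M -> is_matching N ->
  C \subset symdiff M N -> closed (adjacent (symdiff M N)) (mem C) ->
  is_matching (symdiff N C).
Proof.
move=> mM mN /subsetP CD clC.
have kept_added e f v : e \in N -> e \notin C -> f \in M -> f \in C ->
    v \in val e -> v \in val f -> e = f.
  move=> eN eC fM fC ve vf; have [eM|eM] := boolP (e \in M).
    exact: (matching_eq mM) ve vf.
  have De : e \in symdiff M N by rewrite in_symdiff (negbTE eM) eN.
  have := clC e f (adjacent_common_vertex De (CD f fC) ve vf).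
  by rewrite /= fC (negbTE eC).
have added k : k \notin N -> k \in C -> k \in M.
  by move=> kN /CD; rewrite in_symdiff (negbTE kN) addbF.
apply/matchingP => e f v; rewrite !inE.
move=> /orP[/andP[eC eN]|/andP[/added eM eC]];
move=> /orP[/andP[fC fN]|/andP[/added fM fC]] ve vf.
- exact: (matching_eq mN) ve vf.
- exact: kept_added (fM fC) _ ve vf.
- by symmetry; apply: kept_added (eM eC) _ vf ve.
- exact: (matching_eq mM (eM eC) (fM fC)) ve vf.
Qed.

End Matchings.

Section Polytope.
Variables (R : realType) (n : nat).
Implicit Types (x y z g : vec R n) (v w : 'I_n) (c : constr n) (F : pred (edge n)).
Implicit Types (a b e f k : edge n) (M N : {set edge n}).

(** * Vertices of the matching polytope *)

Lemma chi_ge0 M e : 0 <= chi R M e.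
Proof. by rewrite /chi; case: ifP. Qed.

Lemma chi_le1 M e : chi R M e <= 1.
Proof. by rewrite /chi; case: ifP. Qed.

Lemma chi_inj : injective (@chi R n).
Proof.
move=> M N MN; apply/setP => e; have /eqP := congr1 (@^~ e) MN; rewrite /chi /=.
by do 2 case: (e \in _); rewrite ?oner_eq0 // eq_sym oner_eq0.
Qed.

Lemma xsum_chi M F : xsum (chi R M) F = #|[set e in M | F e]|%:R.
Proof.
rewrite /xsum /chi -big_mkcondr sumr_const; congr (_ %:R).
by apply: eq_card => e; rewrite !inE andbC.
Qed.

Lemma in_Pmatch_ge0 x e : in_Pmatch x -> 0 <= x e.
Proof.
move=> [lam [lam0 [_ [_ ->]]]]; apply: sumr_ge0 => M _.
by rewrite mulr_ge0 ?chi_ge0.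
Qed.

Lemma in_Pmatch_le1 x e : in_Pmatch x -> x e <= 1.
Proof.
move=> [lam [lam0 [_ [lam1 ->]]]]; rewrite -lam1; apply: ler_sum => M _.
by rewrite ler_piMr ?chi_le1.
Qed.

Lemma in_Pmatch_chi M : is_matching M -> in_Pmatch (chi R M).
Proof.
move=> mM; exists (fun N => (N == M)%:R); split; first by move=> N; case: eqP.
split; first by move=> N; case: eqP => // ->; rewrite mM.
split=> [|e]; first by rewrite (bigD1 M) //= eqxx big1 ?addr0 // => N /negbTE->.
rewrite (bigD1 M) //= eqxx mul1r big1 ?addr0 // => N /negbTE->.
by rewrite mul0r.
Qed.

Lemma vertex_chi M : is_matching M -> is_vertex (chi R M).
Proof.
move=> mM; split=> [|y z t yP zP t0 t1 chiE e]; first exact: in_Pmatch_chi.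
have := chiE e; have := in_Pmatch_ge0 e yP; have := in_Pmatch_ge0 e zP.
have := in_Pmatch_le1 e yP; have := in_Pmatch_le1 e zP.
rewrite /chi; case: ifP => _; nra.
Qed.

Lemma convex_weight_gt0 (I : finType) (lam : I -> R) :
  (forall i, 0 <= lam i) -> \sum_i lam i = 1 -> exists i, 0 < lam i <= 1.
Proof.
move=> lam0 lam1; have [i li] : exists i, lam i != 0.
  apply/existsP; rewrite -negb_forall; apply/negP => /forallP lam_eq0.
  by move/eqP: lam1; rewrite big1 1?eq_sym ?oner_eq0 // => i _; apply/eqP.
by exists i; rewrite lt0r li lam0 -lam1 (bigD1 i) //= lerDl sumr_ge0.
Qed.

(* Only half of the weight of [M] is split off, so that [t < 1] even when [x] is
   [chi R M] itself. *)
Lemma in_Pmatch_split x : in_Pmatch x ->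
  exists M z t, [/\ is_matching M, in_Pmatch z, 0 < t < 1 &
    forall e, x e = t * chi R M e + (1 - t) * z e].
Proof.
move=> [lam [lam0 [lamM [lam1 xE]]]].
have [M /andP[lM lM1]] := convex_weight_gt0 lam0 lam1.
pose t := lam M / 2; have t01 : 0 < t < 1 by rewrite /t; apply/andP; split; lra.
have t1 : 1 - t != 0 by rewrite gt_eqF // subr_gt0; case/andP: t01.
pose rest N := (lam N - t * (N == M)%:R) / (1 - t).
exists M, (fun e => \sum_N rest N * chi R N e), t; split=> //.
- by apply: contraTT lM => /lamM ->; rewrite ltxx.
- exists rest; split=> [N|].
    rewrite divr_ge0 //; last lra.
    by have [->|_] := eqVneq N M; rewrite ?mulr0 ?subr0 // mulr1 /t; lra.
  split=> [N nN|].
    rewrite /rest lamM //; case: eqP nN => [->|_ _]; last by rewrite mulr0 subrr mul0r.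
    by move/lamM => lM0; rewrite lM0 ltxx in lM.
  split=> //; rewrite -mulr_suml sumrB lam1 -mulr_sumr (bigD1 M) //= eqxx big1.
    by rewrite addr0 mulr1 divff.
  by move=> N /negbTE->.
- move=> e; rewrite xE mulr_sumr.
  have -> : t * chi R M e = \sum_N t * (N == M)%:R * chi R N e.
    rewrite (bigD1 M) //= eqxx mulr1 big1 ?addr0 // => N /negbTE->.
    by rewrite mulr0 mul0r.
  rewrite -big_split; apply: eq_bigr => N _ /=.
  by rewrite mulrA /rest [(1 - t) * _]mulrC divfK // -mulrDl addrC subrK.
Qed.

Lemma vertex_matching x : is_vertex x -> exists2 M, is_matching M & x = chi R M.
Proof.
move=> [/in_Pmatch_split[M [z [t [mM zP /andP[t0 t1] xE]]]] extreme].
have chiz e : chi R M e = z e by apply: (extreme _ _ t) => //; apply: in_Pmatch_chi.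
by exists M => //; apply: funext => e; rewrite xE -chiz -mulrDl addrC subrK mul1r.
Qed.

(** * Circuits *)

Definition Bsupp_sub y g := forall c, Bsupp y c -> Bsupp g c.

Lemma Bsupp_sub_row_eq0 y g c :
  Bsupp_sub y g -> is_row c -> Brow c g = 0 -> Brow c y = 0.
Proof.
move=> yg rc g0; apply/eqP/negPn/negP => y0.
by have := yg c; rewrite /Bsupp rc y0 g0 eqxx => /(_ isT).
Qed.

Lemma Bsupp_sub_entry_eq0 y g e : Bsupp_sub y g -> g e = 0 -> y e = 0.
Proof.
move=> yg ge; apply: oppr_inj; rewrite oppr0.
by apply: (Bsupp_sub_row_eq0 (c := NonNeg e) yg); rewrite //= ge oppr0.
Qed.

Lemma Bsupp_scale (t : R) g : t != 0 -> Bsupp (fun e => t * g e) =1 Bsupp g.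
Proof.
move=> t0 c; rewrite /Bsupp; congr (_ && ~~ _).
have xsum_scale F : xsum (fun e => t * g e) F = t * xsum g F.
  by rewrite /xsum mulr_sumr.
by case: c => [T|v|e]; rewrite /= ?xsum_scale -?mulrN mulf_eq0 (negbTE t0).
Qed.

Lemma circuit_scale (t : R) g : t != 0 -> is_circuit g -> is_circuit (fun e => t * g e).
Proof.
move=> t0 [[e ge] gmin]; split; first by exists e; rewrite mulf_neq0.
move=> y y0 yg c; rewrite Bsupp_scale // => /gmin; apply=> // c' /yg.
by rewrite Bsupp_scale.
Qed.

(* The rows force [y e / g e = y f / g f]. *)
Definition tied g e f := forall y, Bsupp_sub y g -> y e * g f = y f * g e.

Lemma tied_sym g e f : tied g e f -> tied g f e.
Proof. by move=> ef y /ef->. Qed.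

Lemma tied_trans g e f k : g f != 0 -> tied g e f -> tied g f k -> tied g e k.
Proof.
move=> gf ef fk y yg; apply: (mulIf gf).
by rewrite mulrAC ef // mulrAC fk // mulrAC.
Qed.

Lemma circuit_of_tied g : nonzero g ->
  (forall e f, g e != 0 -> g f != 0 -> tied g e f) -> is_circuit g.
Proof.
move=> [f gf] all_tied; split=> [|y [k yk] yg]; first by exists f.
pose t := y f / g f.
have yE : y = (fun e => t * g e).
  apply: funext => e; have [ge|ge] := eqVneq (g e) 0.
    by rewrite (Bsupp_sub_entry_eq0 yg ge) ge mulr0.
  by rewrite /t mulrAC (all_tied f e) // mulfK.
have t0 : t != 0 by apply: contraNneq yk => t0; rewrite yE t0 mul0r.
by move=> c; rewrite yE Bsupp_scale.
Qed.

Lemma xsum_pair g F e f : e != f -> F e -> F f ->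
  (forall k, F k -> g k != 0 -> k \in [set e; f]) -> xsum g F = g e + g f.
Proof.
move=> ef Fe Ff supp; rewrite /xsum (bigD1 e) //.
rewrite (bigD1 f) /=; last by rewrite Ff eq_sym.
rewrite big1 ?addr0 // => k /andP[/andP[Fk ke] kf]; apply/eqP.
by apply: contraTT ke => /(supp k Fk); rewrite !inE (negbTE kf) orbF negbK.
Qed.

Lemma tied_of_row g c F e f : is_row c -> (forall y, Brow c y = xsum y F) ->
  e != f -> F e -> F f -> (forall k, F k -> g k != 0 -> k \in [set e; f]) ->
  g e + g f = 0 -> tied g e f.
Proof.
move=> rc cF ef Fe Ff supp g0 y yg.
have y0 : y e + y f = 0.
  rewrite -(xsum_pair ef Fe Ff) -?cF => [|k Fk yk].
    by apply: Bsupp_sub_row_eq0 yg rc _; rewrite cF (xsum_pair ef).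
  by apply: supp => //; apply: contraNneq yk => /(Bsupp_sub_entry_eq0 yg)->.
by rewrite -(addr0_eq y0) -(addr0_eq g0) mulrN mulNr.
Qed.

Lemma Bsupp_sub_chi1 g e : g e != 0 ->
  (forall v, v \in val e -> xsum g (delta v) != 0) ->
  (forall T : {set 'I_n}, odd #|T| -> val e \subset T -> xsum g (inside T) != 0) ->
  Bsupp_sub (chi R [set e]) g.
Proof.
move=> ge gv gT.
have meets F : xsum (chi R [set e]) F != 0 -> F e.
  rewrite xsum_chi pnatr_eq0 -lt0n => /card_gt0P[f].
  by rewrite !inE => /andP[/eqP->].
move=> [T|v|f]; rewrite /Bsupp /=.
- by move=> /andP[/andP[oT T3] /meets eT]; rewrite oT T3 gT.
- by move=> /meets ve; rewrite gv.
- by rewrite !oppr_eq0 /chi inE; have [->|_] := eqVneq f e; rewrite ?eqxx.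
Qed.

Lemma circuit_supported_at g e : is_circuit g -> Bsupp_sub (chi R [set e]) g ->
  forall f, f != e -> g f = 0.
Proof.
move=> [_ gmin] eg f fe; apply: (@Bsupp_sub_entry_eq0 g (chi R [set e])).
  by apply: gmin => //; exists e; rewrite /chi inE eqxx oner_eq0.
by rewrite /chi inE (negbTE fe).
Qed.

Lemma circuit_ge0 g : is_circuit g -> (forall e, 0 <= g e) ->
  exists2 e, 0 < g e & forall f, f != e -> g f = 0.
Proof.
move=> cg g0; have [[e ge] _] := cg; have ge_gt0 : 0 < g e by rewrite lt0r ge g0.
have row_neq0 F : F e -> xsum g F != 0.
  by move=> Fe; rewrite gt_eqF // /xsum (bigD1 e) //= ltr_pwDl // sumr_ge0.
exists e => // f; apply: circuit_supported_at => //.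
by apply: Bsupp_sub_chi1 => // *; apply: row_neq0.
Qed.

(** * Circuits joining two matchings *)

Definition chi_diff M N : vec R n := fun e => chi R N e - chi R M e.

Lemma chi_diff_neq0 M N e : (chi_diff M N e != 0) = (e \in symdiff M N).
Proof.
by rewrite in_symdiff /chi_diff /chi; do 2 case: (e \in _);
  rewrite ?subrr ?sub0r ?subr0 ?oppr_eq0 ?oner_eq0 ?eqxx.
Qed.

Lemma xsum_chi_diff_neq0 M N F :
  (xsum (chi_diff M N) F != 0) = (#|[set e in N | F e]| != #|[set e in M | F e]|).
Proof.
have -> : xsum (chi_diff M N) F = xsum (chi R N) F - xsum (chi R M) F.
  by rewrite /xsum sumrB.
by rewrite !xsum_chi subr_eq0 eqr_nat.
Qed.

Lemma circuit_chi_diffC M N : is_circuit (chi_diff M N) -> is_circuit (chi_diff N M).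
Proof.
have -> : chi_diff N M = (fun e => -1 * chi_diff M N e).
  by apply: funext => e; rewrite mulN1r opprB.
by apply: circuit_scale; rewrite oppr_eq0 oner_eq0.
Qed.

Lemma circuit_step_chi M N : is_matching M -> is_matching N ->
  circuit_step (chi R M) (chi R N) <-> is_circuit (chi_diff M N).
Proof.
move=> mM mN; split=> [[g [t [cg [t0 [_ [_ NE]]]]]]|cMN].
  have -> : chi_diff M N = (fun e => t * g e).
    by apply: funext => e; rewrite /chi_diff NE addrAC subrr add0r.
  by apply: circuit_scale; rewrite ?gt_eqF.
have NE e : chi R N e = chi R M e + 1 * chi_diff M N e by rewrite mul1r addrC subrK.
exists (chi_diff M N), 1; do 2 split=> //.
have <- : chi R N = (fun e => chi R M e + 1 * chi_diff M N e) by apply: funext.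
split; first exact: in_Pmatch_chi.
split=> // t t1 tP; have [[e de] _] := cMN.
have := in_Pmatch_ge0 e tP; have := in_Pmatch_le1 e tP.
by move: de; rewrite /chi_diff /chi; do 2 case: ifP => _; rewrite ?subrr ?eqxx //; lra.
Qed.

Lemma tied_exchange M N c F e f : is_row c -> (forall y, Brow c y = xsum y F) ->
  e \in M :\: N -> f \in N :\: M -> F e -> F f ->
  {in symdiff M N, forall k, F k -> k \in [set e; f]} -> tied (chi_diff M N) e f.
Proof.
move=> rc cF /setDP[eM eN] /setDP[fN fM] Fe Ff only.
apply: (tied_of_row rc cF) => // [|k Fk|].
- by apply: contraNneq eN => ->.
- by rewrite chi_diff_neq0 => /only; apply.
- by rewrite /chi_diff /chi eM fN (negbTE eN) (negbTE fM) sub0r subr0 addNr.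
Qed.

Lemma tied_incident M N e f v : is_matching M -> is_matching N ->
  e \in symdiff M N -> f \in symdiff M N -> v \in val e -> v \in val f ->
  tied (chi_diff M N) e f.
Proof.
move=> mM mN.
have exchange a b : a \in M :\: N -> b \in N :\: M -> v \in val a -> v \in val b ->
    tied (chi_diff M N) a b.
  move=> aMN bNM va vb; apply: (@tied_exchange M N (Deg v) (delta v)) => // k.
  case/setDP: aMN bNM => aM _ /setDP[bN _]; rewrite !inE /delta.
  move=> /orP[/andP[_ kM]|/andP[_ kN]] vk.
    by rewrite (matching_eq mM kM aM vk va) eqxx.
  by rewrite (matching_eq mN kN bN vk vb) eqxx orbT.
move=> /setUP[] De /setUP[] Df ve vf.
- by case/setDP: De Df => eM _ /setDP[fM _]; rewrite (matching_eq mM eM fM ve vf).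
- exact: exchange.
- exact/tied_sym/exchange.
- by case/setDP: De Df => eN _ /setDP[fN _]; rewrite (matching_eq mN eN fN ve vf).
Qed.

(* The row of the odd set [e + f + w] sees no edge of the difference but [e] and [f]. *)
Lemma tied_oddset M N e f w : e \in M :\: N -> f \in N :\: M ->
  {in symdiff M N, forall k, w \in val k ->
     [disjoint val k & val e] && [disjoint val k & val f]} ->
  {in symdiff M N, forall k, [disjoint val k & val e] || [disjoint val k & val f]} ->
  tied (chi_diff M N) e f.
Proof.
move=> eMN fNM w_avoids not_both; pose T := w |: (val e :|: val f).
have De : e \in symdiff M N by apply/setUP; left.
have Df : f \in symdiff M N by apply/setUP; right.
have we : w \notin val e.
  by apply/negP => /(w_avoids e De); rewrite edge_meets_self.
have wf : w \notin val f.
  by apply/negP => /(w_avoids f Df); rewrite edge_meets_self andbF.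
have ef : [disjoint val e & val f] by have := not_both e De; rewrite edge_meets_self.
have T5 : #|T| = 5%N.
  by rewrite cardsU1 !inE negb_or we wf cardsU disjoint_setI0 // cards0 !card_edge.
apply: (@tied_exchange M N (OddSet T) (inside T)) => //.
- by rewrite /= T5.
- by apply/subsetP => v ve; rewrite !inE ve orbT.
- by apply/subsetP => v vf; rewrite !inE vf !orbT.
move=> k Dk /subsetP kT; have [wk|wk] := boolP (w \in val k).
  have /andP[ke kf] := w_avoids k Dk wk.
  have [v vk vw] := edge_other_vertex k w.
  by have := kT v vk; rewrite !inE (negbTE vw) (disjointFr ke vk) (disjointFr kf vk).
have kef v : v \in val k -> (v \in val e) || (v \in val f).
  move=> vk; have := kT v vk; rewrite !inE; case: eqVneq => // vw.
  by rewrite -vw vk in wk.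
have [ke|kf] := orP (not_both k Dk); apply/set2P; [right|left]; apply: edge_subset_eq.
  by apply/subsetP => v vk; have := kef v vk; rewrite (disjointFr ke vk).
by apply/subsetP => v vk; have := kef v vk; rewrite (disjointFr kf vk) orbF.
Qed.

Lemma tied_connected M N e f : is_matching M -> is_matching N ->
  connect (adjacent (symdiff M N)) e f -> tied (chi_diff M N) e f.
Proof.
move=> mM mN /connectP[p + ->]; elim: p e => [|k p IH] e //= /andP[ek kp].
case/and3P: ek => De Dk /disjoint_edgePn[v ve vk].
apply: tied_trans (IH k kp); first by rewrite chi_diff_neq0.
exact: (tied_incident mM mN) ve vk.
Qed.

Lemma circuit_of_connected M N : is_matching M -> is_matching N -> M != N ->
  {in symdiff M N &, forall e f, connect (adjacent (symdiff M N)) e f} ->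
  is_circuit (chi_diff M N).
Proof.
move=> mM mN; rewrite -symdiff_eq0 => /set0Pn[e De] conn.
apply: circuit_of_tied; first by exists e; rewrite chi_diff_neq0.
move=> f k; rewrite !chi_diff_neq0 => Df Dk.
by apply: tied_connected => //; apply: conn.
Qed.

Lemma circuit_of_exchange M N : ~~ (M \subset N) -> ~~ (N \subset M) ->
  {in M :\: N & N :\: M, forall e f, tied (chi_diff M N) e f} ->
  is_circuit (chi_diff M N).
Proof.
move=> /subsetPn[a aM aN] /subsetPn[b bN bM] exchange.
have aMN : a \in M :\: N by rewrite inE aN.
have bNM : b \in N :\: M by rewrite inE bM.
have da : chi_diff M N a != 0 by rewrite chi_diff_neq0 inE aMN.
have db : chi_diff M N b != 0 by rewrite chi_diff_neq0 inE bNM orbT.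
apply: circuit_of_tied => [|e f]; first by exists a.
rewrite !chi_diff_neq0 => /setUP[] De /setUP[] Df.
- by apply: tied_trans db (exchange e b De bNM) _; apply/tied_sym/exchange.
- exact: exchange.
- exact/tied_sym/exchange.
- by apply: (tied_trans da _ (exchange a f aMN Df)); apply/tied_sym/exchange.
Qed.

Lemma circuit_of_three_components M N : is_matching M -> is_matching N ->
  ~~ (M \subset N) -> ~~ (N \subset M) -> (2 < #|components (symdiff M N)|)%N ->
  is_circuit (chi_diff M N).
Proof.
move=> mM mN nMN nNM many; apply: circuit_of_exchange => // e f eMN fNM.
have [De Df] : e \in symdiff M N /\ f \in symdiff M N.
  by rewrite !in_setU eMN fNM orbT.
have [ef|ef] := boolP (connect (adjacent (symdiff M N)) e f).
  exact: tied_connected.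
have [h Dh] := exists_off_two_components e f many.
rewrite in_setU !in_component Dh /= negb_or => /andP[eh fh].
have [w wh] := edge_nonempty h.
have link a b v : a \in symdiff M N -> b \in symdiff M N ->
    v \in val a -> v \in val b -> connect (adjacent (symdiff M N)) a b.
  by move=> Da Db va vb; apply/connect1/(adjacent_common_vertex Da Db va vb).
apply: (tied_oddset (w := w)) => // k Dk.
  move=> wk; have hk : connect (adjacent (symdiff M N)) k h by apply: (link k h w).
  apply/andP; split; [apply: contraNT eh|apply: contraNT fh];
  move=> /disjoint_edgePn[v vk va]; apply: connect_trans hk;
  exact: (link _ _ v).
apply: contraNT ef; rewrite negb_or => /andP[].
move=> /disjoint_edgePn[u uk ue] /disjoint_edgePn[v vk vf].
by apply: (connect_trans (y := k)); [apply: (link _ _ u)|apply: (link _ _ v)].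
Qed.

(** * Upper bounds *)

Definition circuit_distance_le (d : nat) x y :=
  exists l, (l <= d)%N /\ circuit_walk l x y.

Lemma walk_components M N : is_matching M -> is_matching N ->
  circuit_walk #|components (symdiff M N)| (chi R M) (chi R N).
Proof.
move=> mM; move cE: #|components _| => l.
elim: l N cE => [|l IH] N cE mN /=.
  have /eqP := cE; rewrite cards_eq0 components_eq0 symdiff_eq0 => /eqP-> //.
have [e De] : exists e, e \in symdiff M N.
  by apply/set0Pn; rewrite -components_eq0 -card_gt0 cE.
set C := component (symdiff M N) e.
have CD : C \subset symdiff M N := component_subset _ _.
have mN' : is_matching (symdiff N C) := matching_symdiff mM mN CD (component_closed e).
exists (chi R (symdiff N C)); split.
  apply: IH => //; rewrite symdiff_symdiff_sub // components_setD.
  have := cardsD1 C (components (symdiff M N)).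
  by rewrite cE (imset_f (component _) De) => -[].
apply/circuit_step_chi => //; apply: circuit_of_connected; rewrite // ?symdiffKr.
  by rewrite -symdiff_eq0 symdiffKr; apply/set0Pn; exists e; apply: mem_component.
exact: component_connected.
Qed.

Lemma circuit_distance_le_half M N : is_matching M -> is_matching N ->
  circuit_distance_le n./2 (chi R M) (chi R N).
Proof.
move=> mM mN; exists #|components (symdiff M N)|; split; last exact: walk_components.
by rewrite geq_half_double card_components.
Qed.

Lemma exists_bridge N a b : is_matching N -> a \in N -> b \in N -> a != b ->
  exists2 e, e \notin N & val e \subset val a :|: val b.
Proof.
move=> mN aN bN ab; have [[u ua] [v vb]] := (edge_nonempty a, edge_nonempty b).
have uv : u != v.
  by apply: contraNneq ab => uv; rewrite (matching_eq mN aN bN ua) ?uv.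
have [e eE] := exists_edge uv.
exists e; last by rewrite eE subUset !sub1set !inE ua vb orbT.
apply: contraNN ab => eN; rewrite -(matching_eq mN eN aN _ ua) ?eE ?set21 //.
by rewrite (matching_eq mN eN bN _ vb) ?eE ?set22.
Qed.

Lemma bridge_neighbor N a b e k : is_matching N ->
  a \in N -> b \in N -> k \in N ->
  val e \subset val a :|: val b -> ~~ [disjoint val k & val e] -> k \in [set a; b].
Proof.
move=> mN aN bN kN /subsetP eab /disjoint_edgePn[v vk /eab/setUP[va|vb]].
  by rewrite (matching_eq mN kN aN vk va) !inE eqxx.
by rewrite (matching_eq mN kN bN vk vb) !inE eqxx orbT.
Qed.

(* The bridge [e] is tied to an edge [f] off it by the odd set [e + f + w], where the
   vertex [w] outside [a], [b] and [f] exists because [n >= 7]. *)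
Lemma circuit_of_bridge M N a b e : (7 <= n)%N ->
  is_matching (e |: M) -> is_matching N -> M \subset N -> e \notin N ->
  a \in N :\: M -> b \in N -> val e \subset val a :|: val b ->
  is_circuit (chi_diff (e |: M) N).
Proof.
move=> n7 meM mN MN eN aNM bN eab; have /setDP[aN aM] := aNM.
have eMN : (e |: M) :\: N = [set e].
  rewrite setDUl (eqP (_ : M :\: N == set0)) ?setD_eq0 // setU0.
  by apply/setDidPl; rewrite disjoints1.
have in_diff k : k \in symdiff (e |: M) N -> k = e \/ k \in N.
  by rewrite in_setU eMN => /orP[/set1P|/setDP[]]; [left|right].
apply: circuit_of_exchange.
- by apply/subsetPn; exists e; rewrite ?setU11.
- apply/subsetPn; exists a => //; rewrite !inE (negbTE aM) orbF.
  by apply: contraNneq eN => <-.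
move=> e' f; rewrite eMN => /set1P-> fNM; have /setDP[fN _] := fNM.
have e_diff : e \in (e |: M) :\: N by rewrite eMN set11.
have [ef|/disjoint_edgePn[v ve vf]] := boolP [disjoint val e & val f]; last first.
  by apply: (tied_incident (v := v)); rewrite // in_setU ?e_diff ?fNM ?orbT.
have [w w_off] := exists_vertex_off_edges (s := [:: a; b; f]) n7.
have wab : w \notin val a :|: val b by rewrite in_setU negb_or !w_off ?inE ?eqxx ?orbT.
have wf : w \notin val f by rewrite w_off ?inE ?eqxx ?orbT.
have far k : k \in N -> k != f -> [disjoint val k & val f].
  by move=> kN; apply: (matching_disjoint mN).
apply: (tied_oddset (w := w)) => // k /in_diff[->|kN].
- by move=> we; rewrite (subsetP eab) in wab.
- move=> wk; rewrite far // ?andbT; last by apply: contraNneq wf => <-.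
  apply: contraNT wab => /(bridge_neighbor mN aN bN kN eab)/set2P[] <-;
  by rewrite inE wk ?orbT.
- by rewrite ef orbT.
- by have [->|/(far k kN)->] := eqVneq k f; rewrite ?orbT // disjoint_sym ef.
Qed.

Lemma subset_detour M N : (7 <= n)%N -> is_matching N -> M \subset N ->
  (1 < #|N :\: M|)%N ->
  exists M',
    [/\ is_matching M', is_circuit (chi_diff M M') & is_circuit (chi_diff M' N)].
Proof.
move=> n7 mN MN /card_gt1P[a [b [aNM bNM ab]]].
have [/setDP[aN aM] /setDP[bN bM]] := (aNM, bNM).
have [e eN eab] := exists_bridge mN aN bN ab.
have meM : is_matching (e |: M).
  apply: (matchingU1 (matchingS MN mN)) => f fM; rewrite disjoint_sym; apply: contraT.
  move=> /(bridge_neighbor mN aN bN (subsetP MN f fM) eab)/set2P[] fE.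
    by rewrite -fE fM in aM.
  by rewrite -fE fM in bM.
exists (e |: M); split=> //; last exact: circuit_of_bridge aNM bN eab.
have mM := matchingS MN mN.
have eM : e \notin M by apply: contraNN eN; apply/subsetP.
have DE : symdiff M (e |: M) = [set e].
  rewrite symdiff_subset ?subsetUr // setDUl setDv setU0.
  by apply/setDidPl; rewrite disjoints1.
apply: circuit_of_connected => //; last by rewrite DE => _ _ /set1P-> /set1P->.
by rewrite -symdiff_eq0 DE; apply/set0Pn; exists e; rewrite set11.
Qed.

Lemma circuit_distance_le2 M N : (7 <= n)%N -> is_matching M -> is_matching N ->
  circuit_distance_le 2 (chi R M) (chi R N).
Proof.
move=> n7 mM mN; have [few|many] := leqP #|components (symdiff M N)| 2.
  by exists #|components (symdiff M N)|; split=> //; apply: walk_components.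
have via M' : is_matching M' ->
    is_circuit (chi_diff M M') -> is_circuit (chi_diff M' N) ->
    circuit_distance_le 2 (chi R M) (chi R N).
  move=> mM' MM' M'N; exists 2%N; split=> //; exists (chi R M').
  by split; [exists (chi R M); split|]; rewrite ?circuit_step_chi.
have large (A B : {set edge n}) : A \subset B ->
    (2 < #|components (symdiff A B)|)%N -> (1 < #|B :\: A|)%N.
  by move=> /symdiff_subset-> /leq_trans/(_ (card_components_le _))/ltnW.
have [MN|nMN] := boolP (M \subset N).
  have [M' [mM' MM' M'N]] := subset_detour n7 mN MN (large _ _ MN many).
  exact: (via M').
have [NM|nNM] := boolP (N \subset M).
  rewrite symdiffC in many.
  have [M' [mM' NM' M'M]] := subset_detour n7 mM NM (large _ _ NM many).
  by apply: (via M') => //; apply: circuit_chi_diffC.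
exists 1%N; split=> //; exists (chi R M); split=> //; apply/circuit_step_chi => //.
exact: circuit_of_three_components.
Qed.

(** * Lower bounds *)

Lemma step_from_empty z : circuit_step (chi R set0) z -> exists e, z = chi R [set e].
Proof.
have empty0 g t : (fun e => chi R set0 e + t * g e) = (fun e => t * g e).
  by apply: funext => e; rewrite /chi inE add0r.
move=> [g [t [cg [t0 [tP [tmax zE]]]]]]; rewrite empty0 in tP.
have [f|e ge g0] := circuit_ge0 cg.
  by have := in_Pmatch_ge0 f tP; rewrite pmulr_rge0.
have scaleE s : s * g e = 1 -> (fun f => s * g f) = chi R [set e].
  move=> sg; apply: funext => f; rewrite /chi inE.
  by have [->|fe] := eqVneq f e; rewrite ?sg // g0 ?mulr0.
have tg1 : t * g e = 1.
  apply/le_anti; rewrite (in_Pmatch_le1 e tP) /= leNgt; apply/negP => tg.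
  apply: (tmax (g e)^-1); first by rewrite -[ltRHS]mul1r ltr_pdivlMr.
  by rewrite empty0 scaleE ?mulVf ?gt_eqF //; apply/in_Pmatch_chi/matching1.
by exists e; rewrite -(scaleE t tg1) -(empty0 g t); apply: funext.
Qed.

(* Among six vertices, an odd set containing two disjoint edges misses at most one. *)
Lemma oddset_contains_two_edges N a e (T : {set 'I_n}) : (n <= 6)%N ->
  is_matching N -> (2 < #|N|)%N -> a \in N -> [disjoint val a & val e] ->
  odd #|T| -> val a \subset T -> val e \subset T ->
  (1 < #|[set k in N | inside T k]|)%N.
Proof.
move=> n6 mN N3 aN ae oT aT eT.
have T4 : (4 <= #|T|)%N.
  have <- : #|val a :|: val e| = 4%N.
    by rewrite cardsU disjoint_setI0 // cards0 !card_edge.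
  by rewrite subset_leq_card // subUset aT.
have CT : (#|~: T| < #|N :\ a|)%N.
  have T5 : (4 < #|T|)%N by rewrite ltn_neqAle T4 andbT; apply: contraTneq oT => <-.
  have CT1 : (#|~: T| <= 1)%N.
    by rewrite -(leq_add2l #|T|) cardsC card_ord addn1 (leq_trans n6).
  apply: leq_ltn_trans CT1 _; by move: N3; rewrite (cardsD1 a N) aN.
have mNa := matchingS (subsetDl N [set a]) mN.
have [k /setD1P[ka kN] kT] := matching_disjoint_from mNa CT.
apply/card_gt1P; exists a, k; rewrite !inE aN kN /inside aT eq_sym ka.
by split=> //; rewrite subsets_disjoint.
Qed.

Lemma single_edge_not_circuit N e : (n <= 6)%N -> is_matching N -> (2 < #|N|)%N ->
  ~ is_circuit (chi_diff [set e] N).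
Proof.
move=> n6 mN N3 cir.
have [a aN ae] := matching_disjoint_from mN (leq_ltn_trans (eq_leq (card_edge e)) N3).
have ea : e != a by rewrite eq_sym edge_disjoint_neq.
have row_neq0 F : F a -> (F e -> 1 < #|[set k in N | F k]|)%N ->
    xsum (chi_diff [set e] N) F != 0.
  move=> Fa Fe; rewrite xsum_chi_diff_neq0 gtn_eqF //; have [/Fe|nFe] := boolP (F e).
    apply: leq_ltn_trans; rewrite -[leqRHS](cards1 e) subset_leq_card //.
    by apply/subsetP => k /setIdP[].
  rewrite (eq_card0 (_ : _ =i pred0)) => [|k]; last first.
    by rewrite !inE; case: eqP => // ->; rewrite (negbTE nFe).
  by apply/card_gt0P; exists a; rewrite inE aN.
have g_only_a : forall k, k != a -> chi_diff [set e] N k = 0.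
  apply: circuit_supported_at => //; apply: Bsupp_sub_chi1 => [|v va|T oT aT].
  - by rewrite chi_diff_neq0 in_symdiff inE aN eq_sym (negbTE ea).
  - by apply: row_neq0 => //; rewrite /delta (disjointFr ae va).
  - by apply: row_neq0 => // eT; apply: oddset_contains_two_edges aN ae oT aT eT.
have /subsetPn[k kN] : ~~ (N \subset [set a; e]).
  by apply: contraL N3 => /subset_leq_card; rewrite cards2 eq_sym ea -leqNgt.
rewrite !inE negb_or => /andP[/g_only_a/eqP + ke].
by apply/negP; rewrite chi_diff_neq0 in_symdiff inE kN (negbTE ke).
Qed.

Lemma walk_from_empty_ge N l : is_matching N -> (#|N| <= 2)%N || (n <= 6)%N ->
  circuit_walk l (chi R set0) (chi R N) -> (#|N| <= l)%N.
Proof.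
move=> mN small; case: l => [|[|[|l]]].
- by move=> /funext/chi_inj <-; rewrite cards0.
- by move=> [z [/funext<- /step_from_empty[e /chi_inj->]]]; rewrite cards1.
- move=> [_ [[z [/funext<- /step_from_empty[e ->]]]]].
  move=> /(circuit_step_chi (matching1 e) mN) cir; rewrite leqNgt; apply/negP => N3.
  by apply: single_edge_not_circuit cir => //; lia.
- by move=> _; have := card_matching mN; lia.
Qed.

End Polytope.

Theorem theorem1 (R : realType) (n : nat) (hn : (2 <= n)%N) :
  circuit_diameter_is R n
    (if (n <= 3)%N then 1%N
     else if (n <= 5)%N then 2%N
     else if n == 6%N then 3%N
     else 2%N).
Proof.
set d := (if _ then _ else _).
have [d_half d_small] : (d.*2 <= n)%N /\ ((d <= 2)%N || (n <= 6)%N).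
  by rewrite /d; do !case: ifP; lia.
split=> [_ _ /vertex_matching[M mM ->] /vertex_matching[N mN ->]|].
  have [n7|n6] := leqP 7 n.
    have -> : d = 2%N by rewrite /d; do !case: ifP; lia.
    exact: circuit_distance_le2.
  have -> : d = n./2 by rewrite /d; do !case: ifP; lia.
  exact: circuit_distance_le_half.
have [N mN Nd] := exists_matching d_half.
exists (chi R set0), (chi R N).
split; first exact/vertex_chi/matching0.
split=> [|l ld walk]; first exact: vertex_chi.
by have := walk_from_empty_ge mN _ walk; rewrite Nd => /(_ d_small); rewrite leqNgt ld.
Qed.
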